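(* Suppose $K \subset \mathbb{R}$ is a closed set that has the following properties: (1) $K$ contains Cantor sets $K_1, K_2, \ldots$ with disjoint convex hulls $I_1, I_2, \ldots$, so that $I_{n+1}$ lies to the right of $I_n$ for every $n \in \mathbb{N}$. (2) For some $\varepsilon > 0$, we have $\tau(K_n) > 1 + \varepsilon$ for all $n \in \mathbb{N}$. (3) For some $A > a > 0$, we have $2A \ge |I_n| \ge A$ and $\mathrm{dist}(I_n, I_{n+1}) \le a$ for all $n \in \mathbb{N}$. Let $\widetilde K = f(K)$, where $f : \mathbb{R} \to \mathbb{R}$ is given by $f(x) = x^2$. Then $\widetilde K + \widetilde K$ contains a half-line, that is, there is $E_1 \in \mathbb{R}$ with $[E_1, \infty) \subseteq \widetilde K + \widetilde K$.
   Context: A Cantor set $C \subset \mathbb{R}$ is a (nonempty) bounded, perfect (closed without isolated points), nowhere dense set. Let $I$ denote its convex hull. Any connected component of $I \setminus C$ is called a gap of $C$. A presentation of $C$ is an ordering $\mathcal{U} = \{U_n\}_{n \ge 1}$ of the gaps of $C$. If $u \in C$ is a boundary point of a gap $U$ of $C$, let $K$ be the connected component of $I \setminus (U_1 \cup U_2 \cup \cdots \cup U_n)$ (with $n$ chosen so that $U_n = U$) that contains $u$, and write $\tau(C, \mathcal{U}, u) = |K|/|U|$, where $|\cdot|$ denotes the length of an interval. The thickness of $C$ is $\tau(C) = \sup_{\mathcal{U}} \inf_{u} \tau(C, \mathcal{U}, u)$, where the supremum is over all presentations and the infimum is over all boundary points $u$ of gaps of $C$. For $X, Y \subset \mathbb{R}$,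 $X + Y = \{x + y : x \in X, y \in Y\}$. *)

(* Defs.v *)
From HB Require Import structures.
From mathcomp Require Import all_boot all_order all_algebra.
From mathcomp Require Import all_classical all_reals all_analysis.
Set Implicit Arguments.
Unset Strict Implicit.
Unset Printing Implicit Defensive.
Import Order.TTheory GRing.Theory Num.Theory.
Import numFieldNormedType.Exports.
Local Open Scope classical_set_scope.
Local Open Scope ring_scope.

Section Cantor_sets_of_reals.
Context {R : realType}.
Implicit Types (A B C U X Y : set R) (u : R).

Definition nowhere_dense A := interior (closure A) = set0.

Definition cantor_set C :=
  [/\ C !=set0, bounded_set C, perfect_set C & nowhere_dense C].

(* In R, the convex hull is the smallest interval (see [Rhull_smallest]). *)
Definition hull C : set R := [set` Rhull C].

(* Only meaningful on nonempty bounded intervals, the only sets to which it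
   is applied below. *)
Definition len A : R := sup A - inf A.

Definition gap C U : Prop :=
  exists2 x, (hull C `\` C) x & U = connected_component (hull C `\` C) x.

(* Indexed from 0: [U n] stands for U_{n+1}. *)
Definition presentation C (U : nat -> set R) : Prop :=
  set_bij [set: nat] (gap C) U.

Definition boundary A : set R := closure A `\` interior A.

(* The component K of I \ (U_0 u ... u U_n) that contains u. *)
Definition bridge C (U : nat -> set R) (n : nat) u : set R :=
  connected_component (hull C `\` \bigcup_(k in [set k | (k <= n)%N]) U k) u.

(* tau(C, U, u) for u in the boundary of [U n].  The index n, which u
   determines when C is a Cantor set, is kept as an argument. *)
Definition tau_at C (U : nat -> set R) (n : nat) u : R :=
  len (bridge C U n u) / len (U n).

Definition thickness_along C (U : nat -> set R) : \bar R :=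
  ereal_inf [set t | exists n u,
    [/\ C u, boundary (U n) u & t = (tau_at C U n u)%:E]].

Definition thickness C : \bar R :=
  ereal_sup [set thickness_along C U | U in presentation C].

Definition set_dist A B : R :=
  inf [set `|x - y| | x in A & y in B].

Definition set_sum X Y : set R := [set x + y | x in X & y in Y].

End Cantor_sets_of_reals.

(* Main.v *)
Require Import Defs.
From HB Require Import structures.
From mathcomp Require Import all_boot all_order all_algebra.
From mathcomp Require Import all_classical all_reals all_analysis.
From mathcomp Require Import ring lra zify.
Import Order.TTheory GRing.Theory Num.Theory.
Import numFieldNormedType.Exports.
Local Open Scope classical_set_scope.
Local Open Scope ring_scope.

(* Far from the origin, squaring is nearly affine on each hull I_n, so the sets
   f(K_n) have thickness at least 1, and the hulls of f(K_n) and E - f(K_m), for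
   n and m equal or consecutive, have lengths within a factor 3.  By Newhouse's
   gap lemma f(K_n) and E - f(K_m) meet as soon as their hulls do.  Since the
   holes between the I_n are shorter than the I_n, every large E lies in
   f(I_k) + f(I_k) or in f(I_k) + f(I_(k+1)) for some k.

   For the gap lemma: if two disjoint compact sets had a pair of linked gaps,
   the thickness condition would produce linked gaps arbitrarily late in the two
   presentations.  Linked gaps are at least as long as the distance between the
   sets, so only finitely many pairs can be linked. *)

(** * The gap lemma *)

Set Implicit Arguments.
Unset Strict Implicit.

(* (lo n, hi n) is the n-th gap of C, and its bridges only have to contain
   ]bl n, lo n] and [hi n, br n[: unlike being a component, this is visibly
   preserved by the maps applied to C below. *)
Record thick_gaps (R : realType) (tau : R) (C : set R) (lo hi bl br : nat -> R) :
    Prop := ThickGaps {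
  tg_compact : compact C;
  tg_lo : forall n, C (lo n);
  tg_hi : forall n, C (hi n);
  tg_lt : forall n, lo n < hi n;
  tg_gap : forall n x, lo n < x -> x < hi n -> ~ C x;
  tg_cover : forall c d x, C c -> C d -> c < x -> x < d -> ~ C x ->
    exists n, lo n < x /\ x < hi n;
  tg_small : forall delta, 0 < delta ->
    exists N, forall n, delta <= hi n - lo n -> (n < N)%N;
  tg_bl : forall n, exists2 c, C c & c <= bl n;
  tg_br : forall n, exists2 c, C c & br n <= c;
  tg_left : forall n, tau * (hi n - lo n) <= lo n - bl n;
  tg_right : forall n, tau * (hi n - lo n) <= br n - hi n;
  tg_bl_later : forall n k x,
    bl n < x -> x < lo n -> lo k < x -> x < hi k -> (n < k)%N;
  tg_br_later : forall n k x,
    hi n < x -> x < br n -> lo k < x -> x < hi k -> (n < k)%N }.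

(** Only the orientation with the first gap on the left; the other one is obtained by exchanging the
    two sets. *)
Definition linked (R : realType) (lo1 hi1 lo2 hi2 : nat -> R) (i j : nat) :=
  [/\ lo1 i < lo2 j, lo2 j < hi1 i & hi1 i < hi2 j].

(* The two gaps and the bridges adjacent to their overlap cannot satisfy both
   |B_U| < |V| and |B_V| < |U|; the far endpoint of the gap covered by a longer
   bridge then lies in a later gap of the other set.  The orientation of the
   linked pair flips. *)
Lemma linked_step (R : realType) (C1 C2 : set R) lo1 hi1 bl1 br1 lo2 hi2 bl2 br2 :
  thick_gaps 1 C1 lo1 hi1 bl1 br1 -> thick_gaps 1 C2 lo2 hi2 bl2 br2 ->
  C1 `&` C2 = set0 ->
  forall i j, linked lo1 hi1 lo2 hi2 i j ->
  exists i' j', linked lo2 hi2 lo1 hi1 j' i' /\ (i + j < i' + j')%N.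
Proof.
move=> T1 T2 C12 i j [h1 h2 h3].
have R1 := tg_right T1 i; have L2 := tg_left T2 j.
have nC x : C1 x -> C2 x -> False.
  by move=> c1 c2; have : (C1 `&` C2) x by []; rewrite C12.
(* Write U for gap [i] of [C1] and V for gap [j] of [C2]. If the right bridge of U extends beyond V,
   then [hi2 j] falls in a later gap [k] of [C1]. That gap cannot contain the point [hi1 i] of [C1],
   so it starts inside V. *)
have [lt|ge] := ltP (hi2 j) (br1 i).
- have [d Cd dle] := tg_br T1 i.
  have nCv : ~ C1 (hi2 j).
    by move=> c1; apply: (nC _ c1); apply: tg_hi T2 j.
  have [|k [k1 k2]] :=
    tg_cover T1 (tg_hi T1 i) Cd h3 _ nCv.
    by lra.
  have ik := tg_br_later T1 h3 lt k1 k2.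
  have kl : hi1 i <= lo1 k.
    rewrite leNgt; apply/negP => lt'.
    by apply: (tg_gap T1 (n := k) (x := hi1 i)) (tg_hi T1 i) => //; lra.
  by exists k, j; split; [split; lra | rewrite ltn_add2r].
(* Otherwise |U| <= [hi2 j - hi1 i], hence [lo1 i] >= [2 * hi1 i - hi2 j] > [2 * lo2 j - hi2 j] >=
   [bl2 j]: the left bridge of V extends beyond U, and the mirror argument applies. *)
- have lt : bl2 j < lo1 i by lra.
  have [d Cd dle] := tg_bl T2 j.
  have nCv : ~ C2 (lo1 i).
    by apply: nC; apply: tg_lo T1 i.
  have dl : d < lo1 i by lra.
  have [k [k1 k2]] :=
    tg_cover T2 Cd (tg_lo T2 j) dl h1 nCv.
  have ik := tg_bl_later T2 lt h1 k1 k2.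
  have kl : hi2 k <= lo2 j.
    rewrite leNgt; apply/negP => lt'.
    by apply: (tg_gap T2 (n := k) (x := lo2 j)) (tg_lo T2 j) => //; lra.
  by exists i, k; split; [split; lra | rewrite ltn_add2l].
Qed.

(** Iterates [linked_step]; the disjunction absorbs the change of orientation at each step. *)
Lemma linked_unbounded (R : realType) (N : nat) (C1 C2 : set R)
    lo1 hi1 bl1 br1 lo2 hi2 bl2 br2 :
  thick_gaps 1 C1 lo1 hi1 bl1 br1 -> thick_gaps 1 C2 lo2 hi2 bl2 br2 ->
  C1 `&` C2 = set0 ->
  forall i j, linked lo1 hi1 lo2 hi2 i j -> exists i' j',
    (linked lo1 hi1 lo2 hi2 i' j' \/ linked lo2 hi2 lo1 hi1 j' i') /\
    (N <= i' + j')%N.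
Proof.
move=> T1 T2 C12 i j lij.
elim: N => [|N [i' [j' [[l|l] le]]]]; first by exists i, j; split=> //; left.
- have [k [m [l' le']]] := linked_step T1 T2 C12 l.
  by exists k, m; split; [right|lia].
- have C21 : C2 `&` C1 = set0 by rewrite setIC.
  have [k [m [l' le']]] := linked_step T2 T1 C21 l.
  by exists m, k; split; [left|lia].
Qed.

Lemma disjoint_compact_dist (R : realType) (C1 C2 : set R) :
  compact C1 -> compact C2 -> C1 `&` C2 = set0 ->
  exists2 delta : R, 0 < delta &
    forall x y, C1 x -> C2 y -> delta <= `|x - y|.
Proof.
move=> c1 c2 C12.
have [/set0P ne|/negP e] := boolP (C1 `*` C2 != set0); last first.
  exists 1 => // x y Cx Cy; exfalso; apply: e; apply/set0P.
  by exists (x, y).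
have cont : {within C1 `*` C2, continuous (fun z : R * R => `|z.1 - z.2|)}.
  apply: continuous_subspaceT => z; apply: cvg_norm.
  by apply: cvgB; [apply: cvg_fst|apply: cvg_snd].
have [[u v] uv mn] := compact_EVT_min ne (compact_setX c1 c2) cont.
move: uv; rewrite inE /= => -[Cu Cv].
exists `|u - v|.
  rewrite normr_gt0 subr_eq0; apply/eqP => uv.
  have : (C1 `&` C2) u by split=> //; rewrite uv.
  by rewrite C12.
by move=> x y Cx Cy; have := mn (x, y); rewrite inE; apply; split.
Qed.

Lemma no_linked_gaps (R : realType) (C1 C2 : set R)
    lo1 hi1 bl1 br1 lo2 hi2 bl2 br2 :
  thick_gaps 1 C1 lo1 hi1 bl1 br1 -> thick_gaps 1 C2 lo2 hi2 bl2 br2 ->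
  C1 `&` C2 = set0 -> forall i j, ~ linked lo1 hi1 lo2 hi2 i j.
Proof.
move=> T1 T2 C12 i j lij.
have [d d0 dP] := disjoint_compact_dist
  (tg_compact T1) (tg_compact T2) C12.
have [N1 N1P] := tg_small T1 d0.
have [N2 N2P] := tg_small T2 d0.
have [k [m [l le]]] :=
  linked_unbounded (N1 + N2) T1 T2 C12 lij.
suff [kN mN] : (k < N1)%N /\ (m < N2)%N by lia.
(* The overlap of two linked gaps is bounded by a point of [C1] and a point of [C2], so it already
   has length at least [d]. *)
suff len : d <= hi1 k - lo1 k /\ d <= hi2 m - lo2 m.
  by split; [apply: N1P|apply: N2P]; case: len.
case: l => -[h1 h2 h3].
  have := dP _ _ (tg_hi T1 k) (tg_lo T2 m).
  by rewrite ger0_norm; lra.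
have := dP _ _ (tg_lo T1 k) (tg_hi T2 m).
by rewrite ler0_norm; lra.
Qed.

(** The two bridges next to a gap are each at least as long as it, and all three fit inside
    [[l, r]]. *)
Lemma gap_le_third (R : realType) (C : set R) lo hi bl br l r :
  thick_gaps 1 C lo hi bl br -> (forall x, C x -> l <= x <= r) ->
  forall n, 3 * (hi n - lo n) <= r - l.
Proof.
move=> T lr n.
have [c Cc cb] := tg_bl T n.
have [d Cd db] := tg_br T n.
have L := tg_left T n; have H := tg_right T n.
have /andP[? ?] := lr _ Cc; have /andP[? ?] := lr _ Cd.
lra.
Qed.

(** If the sets were disjoint, [l2] would lie in a gap [i] of [C1]. That gap has at most a third of
    the length of the hull of [C1], hence is shorter than the hull of [C2], so [hi1 i] lies between
    [l2] and [r2], in a gap [j] of [C2]. The gaps [i] and [j] are then linked. *)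
Lemma gap_lemma_left (R : realType) (C1 C2 : set R)
    lo1 hi1 bl1 br1 lo2 hi2 bl2 br2 l1 r1 l2 r2 :
  thick_gaps 1 C1 lo1 hi1 bl1 br1 -> thick_gaps 1 C2 lo2 hi2 bl2 br2 ->
  C1 l1 -> C1 r1 -> (forall x, C1 x -> l1 <= x <= r1) ->
  C2 l2 -> C2 r2 -> (forall x, C2 x -> l2 <= x <= r2) ->
  r1 - l1 < 3 * (r2 - l2) -> l1 <= l2 <= r1 -> C1 `&` C2 !=set0.
Proof.
move=> T1 T2 Cl1 Cr1 b1 Cl2 Cr2 b2 sz /andP[le1 le2].
apply/set0P/negP => /eqP C12.
have nC x : C1 x -> C2 x -> False.
  by move=> c1 c2; have : (C1 `&` C2) x by []; rewrite C12.
have nl2 : ~ C1 l2 by move=> /nC; apply.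
have lt1 : l1 < l2.
  by rewrite lt_neqAle le1 andbT; apply/eqP => e; apply: nl2; rewrite -e.
have lt2 : l2 < r1.
  by rewrite lt_neqAle le2 andbT; apply/eqP => e; apply: nl2; rewrite e.
have [i [i1 i2]] := tg_cover T1 Cl1 Cr1 lt1 lt2 nl2.
have := gap_le_third T1 b1 i => third.
have Ch := tg_hi T1 i.
have nh : ~ C2 (hi1 i) by apply: nC.
have ltr : hi1 i < r2 by lra.
have [j [j1 j2]] := tg_cover T2 Cl2 Cr2 i2 ltr nh.
have /andP[lj _] := b2 _ (tg_lo T2 j).
apply: (no_linked_gaps T1 T2 C12 (i := i) (j := j)).
by split=> //; lra.
Qed.

(* The comparison of lengths prevents either set from lying in a gap of the
   other, because gaps of a set of thickness at least 1 occupy at most a third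
   of its hull. *)
Lemma gap_lemma (R : realType) (C1 C2 : set R)
    lo1 hi1 bl1 br1 lo2 hi2 bl2 br2 l1 r1 l2 r2 :
  thick_gaps 1 C1 lo1 hi1 bl1 br1 -> thick_gaps 1 C2 lo2 hi2 bl2 br2 ->
  C1 l1 -> C1 r1 -> (forall x, C1 x -> l1 <= x <= r1) ->
  C2 l2 -> C2 r2 -> (forall x, C2 x -> l2 <= x <= r2) ->
  r1 - l1 < 3 * (r2 - l2) -> r2 - l2 < 3 * (r1 - l1) ->
  l1 <= r2 -> l2 <= r1 -> C1 `&` C2 !=set0.
Proof.
move=> T1 T2 Cl1 Cr1 b1 Cl2 Cr2 b2 sz1 sz2 le1 le2.
have [le|/ltW le] := leP l1 l2.
  by apply: (gap_lemma_left T1 T2 Cl1 Cr1 b1 Cl2 Cr2 b2); rewrite ?le.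
rewrite setIC.
by apply: (gap_lemma_left T2 T1 Cl2 Cr2 b2 Cl1 Cr1 b1); rewrite ?le.
Qed.

(** * Reflection and squaring of thick sets *)

(** Writing E as a sum of points of X and Y amounts to finding a common point of X and E - Y.
    Reflection swaps left and right endpoints and bridges but keeps the numbering of the gaps. *)
Lemma thick_gaps_reflect (R : realType) (E tau : R) (C : set R) lo hi bl br :
  thick_gaps tau C lo hi bl br ->
  thick_gaps tau [set E - x | x in C] (fun n => E - hi n) (fun n => E - lo n)
    (fun n => E - br n) (fun n => E - bl n).
Proof.
move=> T.
have im x : [set E - x | x in C] x <-> C (E - x).
  split; first by move=> [y Cy <-]; rewrite subKr.
  by move=> Cy; exists (E - x) => //; rewrite subKr.
split.
- apply: continuous_compact (tg_compact T).
  apply: continuous_subspaceT => x.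
  by apply: cvgB; [apply: cvg_cst|apply: cvg_id].
- by move=> n; exists (hi n) => //; apply: tg_hi T n.
- by move=> n; exists (lo n) => //; apply: tg_lo T n.
- by move=> n; have := tg_lt T n; lra.
- by move=> n x h1 h2 /im; apply: (tg_gap T (n := n)); lra.
- move=> c d x /im Cc /im Cd h1 h2 /im nC.
  by have [||n [n1 n2]] := tg_cover T Cd Cc _ _ nC;
    [lra|lra|exists n; split; lra].
- move=> delta /(tg_small T)[N NP]; exists N => n le.
  by apply: NP; lra.
- move=> n; have [c Cc cb] := tg_br T n.
  by exists (E - c); [exists c|lra].
- move=> n; have [c Cc cb] := tg_bl T n.
  by exists (E - c); [exists c|lra].
- move=> n; have := tg_right T n.
  by rewrite (_ : E - lo n - (E - hi n) = hi n - lo n); [lra|ring].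
- move=> n; have := tg_left T n.
  by rewrite (_ : E - lo n - (E - hi n) = hi n - lo n); [lra|ring].
- by move=> n k x h1 h2 h3 h4;
    apply: (tg_br_later T (n := n) (k := k) (x := E - x)); lra.
- by move=> n k x h1 h2 h3 h4;
    apply: (tg_bl_later T (n := n) (k := k) (x := E - x)); lra.
Qed.

(* Squaring distorts ratios of lengths on [l, r] by at most a factor r / l,
   which is absorbed by tau. *)
Lemma thick_gaps_sqr (R : realType) (tau l r : R) (C : set R) lo hi bl br :
  thick_gaps tau C lo hi bl br -> 0 < l -> r <= tau * l ->
  (forall x, C x -> l <= x <= r) ->
  thick_gaps 1 [set x ^+ 2 | x in C] (fun n => lo n ^+ 2) (fun n => hi n ^+ 2)
    (fun n => bl n ^+ 2) (fun n => br n ^+ 2).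
Proof.
move=> T l0 rl lr.
have pos x : C x -> 0 < x by move=> /lr /andP[? _]; lra.
have lop n := pos _ (tg_lo T n).
have hip n := pos _ (tg_hi T n).
have tau0 : 0 < tau.
  have /andP[h1 h2] := lr _ (tg_lo T 0).
  rewrite ltNge; apply/negP => tau0; have : tau * l <= 0 by nra.
  by lra.
have lo0 n : 0 <= lo n := ltW (lop n).
have hi0 n : 0 <= hi n := ltW (hip n).
have blp n : l <= bl n.
  by have [c /lr/andP[? _] cb] := tg_bl T n; lra.
have brp n : br n <= r.
  by have [c /lr/andP[_ ?] cb] := tg_br T n; lra.
have bll n : bl n <= lo n.
  have := tg_left T n; have := tg_lt T n.
  by nra.
have brl n : hi n <= br n.
  have := tg_right T n; have := tg_lt T n.
  by nra.
(* Every point of the squared picture is written as a square, so that order conditions pull back to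
   nonnegative numbers. *)
have sq (x : R) : 0 <= x -> exists2 y, 0 <= y & x = y ^+ 2.
  by move=> x0; exists (Num.sqrt x); rewrite ?sqrtr_ge0 ?sqr_sqrtr.
have lt2 (x y : R) : 0 <= x -> 0 <= y -> (x ^+ 2 < y ^+ 2) = (x < y).
  by move=> x0 y0; rewrite ltr_pXn2r.
have im y : 0 <= y -> [set x ^+ 2 | x in C] (y ^+ 2) -> C y.
  move=> y0 [x Cx /eqP]; rewrite eqrXn2 //; first by move=> /eqP <-.
  by have := pos _ Cx; lra.
split.
- apply: continuous_compact (tg_compact T).
  by apply: continuous_subspaceT => x; apply: exprn_continuous.
- by move=> n; exists (lo n) => //; apply: tg_lo T n.
- by move=> n; exists (hi n) => //; apply: tg_hi T n.
- by move=> n; rewrite lt2 //; apply: tg_lt T n.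
- move=> n x h1 h2.
  have [|y y0 e] := sq x; first by have := sqr_ge0 (lo n); lra.
  move: h1 h2; rewrite e !lt2 // => h1 h2 /(im _ y0).
  exact: (tg_gap T h1 h2).
- move=> _ _ x [c Cc <-] [d Cd <-] h1 h2 nC.
  have c0 := ltW (pos _ Cc); have d0 := ltW (pos _ Cd).
  have [|y y0 e] := sq x; first by have := sqr_ge0 c; lra.
  move: h1 h2 nC; rewrite e !lt2 // => h1 h2 nC.
  have [|n [n1 n2]] := tg_cover T Cc Cd h1 h2.
    by move=> Cy; apply: nC; exists y.
  by exists n; rewrite !lt2.
- move=> delta d0.
  have r0 : 0 < r by have /andP[? ?] := lr _ (tg_lo T 0); lra.
  (* Squaring multiplies the length of a gap by [hi n + lo n], which is at most [2 * r]. *)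
  have [|N NP] := tg_small T (delta := delta / (2 * r)).
    by rewrite divr_gt0 //; lra.
  exists N => n le; apply: NP.
  rewrite ler_pdivrMr; last lra.
  have /andP[? ?] := lr _ (tg_lo T n).
  have /andP[? ?] := lr _ (tg_hi T n).
  have := tg_lt T n; nra.
- move=> n; have [c Cc cb] := tg_bl T n.
  by exists (c ^+ 2); [exists c|have := pos _ Cc; nra].
- move=> n; have [c Cc cb] := tg_br T n.
  exists (c ^+ 2); [by exists c|].
  by have := pos _ Cc; have := brl n; have := hip n; nra.
- move=> n; have L := tg_left T n.
  have lt := tg_lt T n.
  have ? := blp n; have ? := bll n.
  have /andP[? ?] := lr _ (tg_hi T n).
  (* A difference of squares is the length times the sum of the endpoints: this sum is at most
     [2 * r <= 2 * (tau * l)] for the gap and at least [2 * l] for the bridge, so the factor [tau]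
     cancels. *)
  have s1 : (hi n - lo n) * (hi n + lo n) <= (hi n - lo n) * (2 * r) by nra.
  have s2 : (hi n - lo n) * (2 * r) <= (hi n - lo n) * (2 * (tau * l)) by nra.
  have s3 : (tau * (hi n - lo n)) * (2 * l) <= (lo n - bl n) * (lo n + bl n).
    by apply: ler_pM; nra.
  by nra.
- move=> n; have L := tg_right T n.
  have lt := tg_lt T n.
  have ? := brp n; have ? := brl n.
  have /andP[? ?] := lr _ (tg_hi T n).
  have /andP[? ?] := lr _ (tg_lo T n).
  have s1 : (hi n - lo n) * (hi n + lo n) <= (hi n - lo n) * (2 * r) by nra.
  have s2 : (hi n - lo n) * (2 * r) <= (hi n - lo n) * (2 * (tau * l)) by nra.
  have s3 : (tau * (hi n - lo n)) * (2 * l) <= (br n - hi n) * (br n + hi n).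
    by apply: ler_pM; nra.
  by nra.
- move=> n k x h1 h2 h3 h4.
  have b0 : 0 <= bl n by have := blp n; lra.
  have [|y y0 e] := sq x; first by have := sqr_ge0 (bl n); lra.
  move: h1 h2 h3 h4; rewrite e !lt2 // => h1 h2 h3 h4.
  exact: (tg_bl_later T h1 h2 h3 h4).
- move=> n k x h1 h2 h3 h4.
  have b0 : 0 <= br n by have := brl n; have := hip n; lra.
  have [|y y0 e] := sq x; first by have := sqr_ge0 (hi n); lra.
  move: h1 h2 h3 h4; rewrite e !lt2 // => h1 h2 h3 h4.
  exact: (tg_br_later T h1 h2 h3 h4).
Qed.

(** * From Cantor sets to thick gaps *)

Lemma compact_has_max (R : realType) (C : set R) :
  compact C -> C !=set0 -> exists2 r, C r & forall x, C x -> x <= r.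
Proof.
move=> cC C0.
have [|r Cr rP] := @compact_EVT_max _ R id C C0 cC.
  by apply: continuous_subspaceT => x; apply: cvg_id.
exists r; first by rewrite inE in Cr.
by move=> x Cx; apply: rP; rewrite inE.
Qed.

Lemma compact_has_min (R : realType) (C : set R) :
  compact C -> C !=set0 -> exists2 l, C l & forall x, C x -> l <= x.
Proof.
move=> cC C0.
have [|r Cr rP] := @compact_EVT_min _ R id C C0 cC.
  by apply: continuous_subspaceT => x; apply: cvg_id.
exists r; first by rewrite inE in Cr.
by move=> x Cx; apply: rP; rewrite inE.
Qed.

Lemma bounded_closed_compactR (R : realType) (C : set R) :
  bounded_set C -> closed C -> compact C.
Proof.
move=> [M [_ MP]] cC.
apply: (subclosed_compact cC (@segment_compact R (- (M + 1)) (M + 1))).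
move=> x Cx; have := MP (M + 1) _ x Cx.
rewrite /= in_itv /= -ler_norml; apply.
by rewrite ltrDl.
Qed.

Lemma hull_itv (R : realType) (C : set R) (l r : R) :
  C l -> C r -> (forall x, C x -> l <= x <= r) -> hull C = `[l, r]%classic.
Proof.
move=> Cl Cr lr; apply/seteqP; split.
  rewrite /hull Rhull_smallest; apply: smallest_sub.
    exact: interval_is_interval.
  by move=> x /lr; rewrite /= in_itv.
move=> x; rewrite /= in_itv /= => xlr.
by apply: interval_is_interval (sub_Rhull Cl) (sub_Rhull Cr) _ xlr.
Qed.

Lemma cantor_hull (R : realType) (C : set R) : cantor_set C ->
  exists l r, [/\ C l, C r, forall x, C x -> l <= x <= r & hull C = `[l, r]%classic].
Proof.
move=> [C0 bC [cC _] _].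
have kC := bounded_closed_compactR bC cC.
have [l Cl lP] := compact_has_min kC C0.
have [r Cr rP] := compact_has_max kC C0.
have lr x : C x -> l <= x <= r by move=> Cx; rewrite lP ?rP.
by exists l, r; split=> //; apply: hull_itv.
Qed.

(** The endpoints are the last point of [C] before [x] and the first one after it; both exist by
    compactness. *)
Lemma gap_itv (R : realType) (C U : set R) : compact C -> gap C U ->
  exists p : R * R, [/\ C p.1, C p.2, p.1 < p.2 & U = `]p.1, p.2[%classic].
Proof.
move=> kC [x [hx nCx] ->].
have cC : closed C by apply: compact_closed kC; apply: Rhausdorff.
(* Otherwise the open half-line to the right of [x] would be an interval containing [C], hence its
   hull, and so [x] itself. *)
have [c Cc cx] : exists2 c, C c & c <= x.
  apply: contrapT => H.
  have : hull C `<=` `]x, +oo[%classic.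
    rewrite /hull Rhull_smallest; apply: smallest_sub.
      exact: interval_is_interval.
    move=> y Cy; rewrite /= in_itv /= andbT ltNge; apply/negP => le.
    by apply: H; exists y.
  by move=> /(_ _ hx); rewrite /= in_itv /= ltxx.
have [d Cd xd] : exists2 c, C c & x <= c.
  apply: contrapT => H.
  have : hull C `<=` `]-oo, x[%classic.
    rewrite /hull Rhull_smallest; apply: smallest_sub.
      exact: interval_is_interval.
    move=> y Cy; rewrite /= in_itv /= ltNge; apply/negP => le.
    by apply: H; exists y.
  by move=> /(_ _ hx); rewrite /= in_itv /= ltxx.
have kl : compact (C `&` [set y | y <= x]).
  by apply: subclosed_compact kC _; [apply: closedI cC (@closed_le _ x)|apply: subIsetl].
have kr : compact (C `&` [set y | x <= y]).
  by apply: subclosed_compact kC _; [apply: closedI cC (@closed_ge _ x)|apply: subIsetl].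
have [|lo [Clo lox] loP] := compact_has_max kl; first by exists c.
have [|hi [Chi xhi] hiP] := compact_has_min kr; first by exists d.
rewrite /= in lox xhi.
have ltlo : lo < x.
  by rewrite lt_neqAle lox andbT; apply/eqP => e; apply: nCx; rewrite -e.
have lthi : x < hi.
  by rewrite lt_neqAle xhi andbT; apply/eqP => e; apply: nCx; rewrite e.
exists (lo, hi); split=> //=; first by lra.
have Dx : (hull C `\` C) x by [].
have iv : is_interval (connected_component (hull C `\` C) x).
  by apply/connected_intervalP/component_connected.
have xx := connected_component_refl Dx.
apply/seteqP; split.
  move=> y Hy; rewrite /= in_itv /=; apply/andP; split; rewrite ltNge; apply/negP => le.
    have /connected_component_sub[_ //] :
      connected_component (hull C `\` C) x lo by apply: iv Hy xx _ _; rewrite le.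
  have /connected_component_sub[_ //] :
    connected_component (hull C `\` C) x hi by apply: iv xx Hy _ _; rewrite xhi.
apply: connected_component_max.
- by rewrite /= in_itv /= ltlo.
- move=> y; rewrite /= in_itv /= => /andP[h1 h2]; split.
    by apply: interval_is_interval (sub_Rhull Clo) (sub_Rhull Chi) _ _; rewrite !ltW.
  move=> Cy; have [le|le] := leP y x.
    by have := loP y (conj Cy le); lra.
  by have := hiP y (conj Cy (ltW le)); lra.
- by apply/connected_intervalP; apply: interval_is_interval.
Qed.

Lemma boundary_itvoo (R : realType) (a b : R) : a < b ->
  boundary `]a, b[%classic a /\ boundary `]a, b[%classic b.
Proof.
move=> ab.
have int : interior `]a, b[%classic = `]a, b[%classic.
  by apply/interior_id; apply: interval_open.
rewrite /boundary int; split; (split; last by rewrite /= in_itv /= ltxx ?andbF).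
  move=> B /nbhs_ballP[e /= e0 eB].
  exists (a + Num.min e (b - a) / 2).
  have m0 : 0 < Num.min e (b - a) by rewrite lt_min e0 subr_gt0.
  have m1 : Num.min e (b - a) <= e by rewrite ge_min lexx.
  have m2 : Num.min e (b - a) <= b - a by rewrite ge_min lexx orbT.
  split; first by rewrite /= in_itv /=; apply/andP; split; lra.
  by apply: eB; rewrite /ball /= ler0_norm; lra.
move=> B /nbhs_ballP[e /= e0 eB].
exists (b - Num.min e (b - a) / 2).
have m0 : 0 < Num.min e (b - a) by rewrite lt_min e0 subr_gt0.
have m1 : Num.min e (b - a) <= e by rewrite ge_min lexx.
have m2 : Num.min e (b - a) <= b - a by rewrite ge_min lexx orbT.
split; first by rewrite /= in_itv /=; apply/andP; split; lra.
by apply: eB; rewrite /ball /= ger0_norm; lra.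
Qed.

(** Among the intervals of length at least [delta], the integer part of [(hi n - l) / delta]
    strictly increases from left to right. It is therefore injective on them, with values in a
    finite range. *)
Lemma disjoint_long_intervals_finite (R : realType) (l r : R) (lo hi : nat -> R) :
  (forall n, l <= lo n) -> (forall n, lo n < hi n) -> (forall n, hi n <= r) ->
  (forall i j, i != j -> hi i <= lo j \/ hi j <= lo i) ->
  forall delta, 0 < delta ->
  exists N, forall n, delta <= hi n - lo n -> (n < N)%N.
Proof.
move=> hl lh hr dis delta d0.
pose A := [set n | delta <= hi n - lo n].
pose g n := Num.truncn ((hi n - l) / delta).
have pos n : 0 <= (hi n - l) / delta.
  by rewrite divr_ge0 ?ltW //; have := hl n; have := lh n; lra.
have gap i j : A i -> A j -> hi i <= lo j -> (g i < g j)%N.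
  rewrite /A /= => Ai Aj ij.
  rewrite /g truncn_gt_nat.
  have /andP[t _] := truncn_itv (pos i).
  apply: (@le_trans _ _ ((hi i - l) / delta + 1)); first by rewrite -natr1 lerD2r.
  rewrite -[X in _ + X](@divff _ delta) ?gt_eqF // -mulrDl.
  by rewrite ler_pM2r ?invr_gt0 //; lra.
have inj : {in A &, injective g}.
  move=> i j; rewrite !inE => Ai Aj gij; apply/eqP; apply: contraT => ne.
  by have [/(gap _ _ Ai Aj)|/(gap _ _ Aj Ai)] := dis _ _ ne; rewrite gij ltnn.
pose M := Num.truncn ((r - l) / delta).
have sub : g @` A `<=` `I_M.+1.
  move=> _ [n _ <-] /=; rewrite ltnS /M truncn_ge_nat.
    have /andP[t _] := truncn_itv (pos n); apply: le_trans t _.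
    by rewrite ler_pM2r ?invr_gt0 //; have := hr n; lra.
  by rewrite divr_ge0 ?ltW //; have := hl n; have := lh n; have := hr n; lra.
have /finite_seqP[s As] : finite_set A.
  by rewrite -(eq_finite_set (inj_card_eq inj)); apply: sub_finite_set sub (finite_II _).
exists (\max_(i <- s) i).+1 => n An; rewrite ltnS.
have ns : n \in s by have : A n by []; rewrite As.
exact: (leq_bigmax_seq (P := xpredT) (F := id) n ns isT).
Qed.

(** The strict inequality yields a single presentation along which every ratio exceeds [tau]. The
    outer ends of the bridges are the infimum and supremum of the components, whether or not these
    are attained. *)
Lemma cantor_thick_gaps (R : realType) (C : set R) (tau : R) :
  cantor_set C -> (tau%:E < thickness C)%E ->
  exists lo hi bl br, thick_gaps tau C lo hi bl br.
Proof.
move=> cC /ereal_sup_gt[_ [U [Ufun Uinj Usurj] <-] thk].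
have [l [r [Cl Cr lr hE]]] := cantor_hull cC.
have kC : compact C by case: cC => _ ? [? _] _; exact: bounded_closed_compactR.
have /choice[p pP] : forall n, exists p : R * R,
    [/\ C p.1, C p.2, p.1 < p.2 & U n = `]p.1, p.2[%classic].
  by move=> n; apply: gap_itv => //; apply: Ufun.
pose lo n := (p n).1; pose hi n := (p n).2.
have Clo n : C (lo n) by case: (pP n).
have Chi n : C (hi n) by case: (pP n).
have lh n : lo n < hi n by case: (pP n).
have UE n : U n = `]lo n, hi n[%classic by case: (pP n).
have Ux n x : U n x <-> lo n < x /\ x < hi n.
  by rewrite UE /= in_itv /=; split=> [/andP[]|[-> ->]].
have free n x : U n x -> ~ C x.
  by have [y _ ->] := Ufun n I => /connected_component_sub[].
have Ulen n : len (U n) = hi n - lo n.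
  by rewrite UE /len sup_itv ?inf_itv // bnd_simp.
have tauP n u : C u -> boundary (U n) u -> tau < tau_at C U n u.
  move=> Cu bu; rewrite -lte_fin; apply: lt_le_trans thk _.
  by apply: ge_ereal_inf; exists (tau_at C U n u)%:E => //; exists n, u.
pose B n u := bridge C U n u.
have Bsub n u x : B n u x -> l <= x <= r /\ forall k, (k <= n)%N -> ~ U k x.
  move=> /connected_component_sub[]; rewrite hE /= in_itv /= => xlr nU.
  by split=> // k kn Ukx; apply: nU; exists k.
have Bu n u : C u -> B n u u.
  move=> Cu; apply: connected_component_refl; split.
    by rewrite hE /= in_itv /=; apply: lr.
  by move=> [k _ /free].
have Bitv n u : is_interval (B n u).
  by apply/connected_intervalP/component_connected.
have Blb n u : has_lbound (B n u) by exists l => x /Bsub[/andP[]].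
have Bub n u : has_ubound (B n u) by exists r => x /Bsub[/andP[]].
(* A component containing [lo n] and a point to its right would contain a point [z] of gap [n],
   which has been removed. *)
have Ble n x : B n (lo n) x -> x <= lo n.
  move=> Bx; rewrite leNgt; apply/negP => lt.
  pose z := Num.min x ((lo n + hi n) / 2).
  have h := lh n.
  have z1 : lo n < z by rewrite lt_min lt; lra.
  have z2 : z <= x by rewrite ge_min lexx.
  have z3 : z <= (lo n + hi n) / 2 by rewrite ge_min lexx orbT.
  have /Bsub[_ /(_ n (leqnn n))] : B n (lo n) z.
    by apply: Bitv (Bu n _ (Clo n)) Bx _ _; rewrite z2 ltW.
  by apply; apply/Ux; split; lra.
have Bge n x : B n (hi n) x -> hi n <= x.
  move=> Bx; rewrite leNgt; apply/negP => lt.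
  pose z := Num.max x ((lo n + hi n) / 2).
  have h := lh n.
  have z1 : z < hi n by rewrite gt_max lt; lra.
  have z2 : x <= z by rewrite le_max lexx.
  have z3 : (lo n + hi n) / 2 <= z by rewrite le_max lexx orbT.
  have /Bsub[_ /(_ n (leqnn n))] : B n (hi n) z.
    by apply: Bitv Bx (Bu n _ (Chi n)) _ _; rewrite z2 ltW.
  by apply; apply/Ux; split; lra.
have supB n : sup (B n (lo n)) = lo n.
  apply/eqP; rewrite eq_le; apply/andP; split.
    by apply: ge_sup => [|x]; [exists (lo n); apply: Bu|apply: Ble].
  by apply: ub_le_sup => //; apply: Bu.
have infB n : inf (B n (hi n)) = hi n.
  apply/eqP; rewrite eq_le; apply/andP; split.
    by apply: ge_inf => //; apply: Bu.
  by apply: lb_le_inf => [|x]; [exists (hi n); apply: Bu|apply: Bge].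
exists lo, hi, (fun n => inf (B n (lo n))), (fun n => sup (B n (hi n))).
split=> //.
- by move=> n x h1 h2; apply: (free n); apply/Ux.
- move=> c d x Cc Cd h1 h2 nCx.
  have Dx : (hull C `\` C) x.
    split=> //; rewrite hE /= in_itv /=.
    by have /andP[? _] := lr _ Cc; have /andP[_ ?] := lr _ Cd; apply/andP; split; lra.
  have [|n _ Un] := Usurj (connected_component (hull C `\` C) x); first by exists x.
  exists n; apply/Ux; rewrite Un; exact: connected_component_refl.
- apply: (@disjoint_long_intervals_finite R l r) => //.
  + by move=> n; have /andP[] := lr _ (Clo n).
  + by move=> n; have /andP[] := lr _ (Chi n).
  move=> i j ij; have [|h1] := leP (hi i) (lo j); first by left.
  have [|h2] := leP (hi j) (lo i); first by right.
  exfalso; move/eqP: ij; apply; apply: Uinj; rewrite ?inE //.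
  (* Two overlapping gaps coincide, since otherwise an endpoint of one, a point of [C], would lie
     inside the other. Injectivity of the presentation then gives [i = j]. *)
  have e1 : lo i = lo j.
    apply/eqP; rewrite eq_le !leNgt; apply/andP; split; apply/negP => lt.
      by apply: (@free j (lo i)) => //; apply/Ux.
    by apply: (@free i (lo j)) => //; apply/Ux.
  have e2 : hi i = hi j.
    apply/eqP; rewrite eq_le !leNgt; apply/andP; split; apply/negP => lt.
      by apply: (@free i (hi j)) => //; apply/Ux; rewrite e1; split.
    by apply: (@free j (hi i)) => //; apply/Ux; rewrite -e1; split.
  by rewrite !UE e1 e2.
- move=> n; exists l => //; apply: lb_le_inf; first by exists (lo n); apply: Bu.
  by move=> x /Bsub[/andP[]].
- move=> n; exists r => //; apply: ge_sup; first by exists (hi n); apply: Bu.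
  by move=> x /Bsub[/andP[]].
- move=> n; have [bd _] := boundary_itvoo (lh n); rewrite -UE in bd.
  have := tauP _ _ (Clo n) bd.
  rewrite /tau_at Ulen ltr_pdivlMr ?subr_gt0 // => /ltW.
  by rewrite /len -/(B _ _) supB.
- move=> n; have [_ bd] := boundary_itvoo (lh n); rewrite -UE in bd.
  have := tauP _ _ (Chi n) bd.
  rewrite /tau_at Ulen ltr_pdivlMr ?subr_gt0 // => /ltW.
  by rewrite /len -/(B _ _) infB.
(* Since [x] lies in the component at stage [n], it avoids every gap of index at most [n]. *)
- move=> n k x h1 h2 h3 h4; rewrite ltnNge; apply/negP => kn.
  have [|b Bb bx] := inf_lt _ h1; first by exists (lo n); apply: Bu.
  have /Bsub[_ /(_ k kn)] : B n (lo n) x.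
    by apply: Bitv Bb (Bu n _ (Clo n)) _ _; rewrite !ltW.
  by apply; apply/Ux.
- move=> n k x h1 h2 h3 h4; rewrite ltnNge; apply/negP => kn.
  have [|b Bb bx] := sup_gt _ h2; first by exists (hi n); apply: Bu.
  have /Bsub[_ /(_ k kn)] : B n (hi n) x.
    by apply: Bitv (Bu n _ (Chi n)) Bb _ _; rewrite !ltW.
  by apply; apply/Ux.
Qed.

(** * Sums of two squares and the half-line *)

(** The gap lemma is applied to the squares of [C1] and to E minus the squares of [C2]. The bounds
    on [E] say exactly that their hulls [[l1^2, r1^2]] and [[E - r2^2, E - l2^2]] meet. *)
Lemma sqr_sum_mem (R : realType) (tau : R) (C1 C2 : set R)
    lo1 hi1 bl1 br1 lo2 hi2 bl2 br2 l1 r1 l2 r2 (E : R) :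
  thick_gaps tau C1 lo1 hi1 bl1 br1 -> thick_gaps tau C2 lo2 hi2 bl2 br2 ->
  C1 l1 -> C1 r1 -> (forall x, C1 x -> l1 <= x <= r1) ->
  C2 l2 -> C2 r2 -> (forall x, C2 x -> l2 <= x <= r2) ->
  0 < l1 -> r1 <= tau * l1 -> 0 < l2 -> r2 <= tau * l2 ->
  r1 ^+ 2 - l1 ^+ 2 < 3 * (r2 ^+ 2 - l2 ^+ 2) ->
  r2 ^+ 2 - l2 ^+ 2 < 3 * (r1 ^+ 2 - l1 ^+ 2) ->
  l1 ^+ 2 + l2 ^+ 2 <= E <= r1 ^+ 2 + r2 ^+ 2 ->
  exists x y, [/\ C1 x, C2 y & x ^+ 2 + y ^+ 2 = E].
Proof.
move=> T1 T2 Cl1 Cr1 b1 Cl2 Cr2 b2 l10 lr1 l20 lr2 s1 s2 /andP[e1 e2].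
have S1 := thick_gaps_sqr T1 l10 lr1 b1.
have S2 := thick_gaps_reflect E (thick_gaps_sqr T2 l20 lr2 b2).
have sq (C : set R) l r : 0 < l -> (forall x, C x -> l <= x <= r) ->
    forall x, [set x ^+ 2 | x in C] x -> l ^+ 2 <= x <= r ^+ 2.
  by move=> l0 b _ [x /b /andP[h1 h2] <-]; apply/andP; split; nra.
have [||||||||||_ [[x Cx <-] [_ [y Cy <-] e]]] :=
    gap_lemma (l1 := l1 ^+ 2) (r1 := r1 ^+ 2)
      (l2 := E - r2 ^+ 2) (r2 := E - l2 ^+ 2) S1 S2.
- by exists l1.
- by exists r1.
- exact: sq.
- by exists (r2 ^+ 2) => //; exists r2.
- by exists (l2 ^+ 2) => //; exists l2.
- by move=> _ [x /(sq _ _ _ l20 b2)/andP[h1 h2] <-]; apply/andP; split; lra.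
- by lra.
- by lra.
- by lra.
- by lra.
by exists x, y; split=> //; lra.
Qed.

Lemma exists_bracket (R : realType) (u : nat -> R) (E : R) :
  u 0%N <= E -> (exists n, E < u n) -> exists k, u k <= E /\ E < u k.+1.
Proof.
move=> h0 [n]; elim: n => [|n IH]; first lra.
by have [le h|lt _] := leP (u n) E; [exists n|apply: IH].
Qed.

Unset Implicit Arguments.

Theorem lemma2p3 (R : realType) (K : set R) (Kn : nat -> set R) (eps A a : R)
  (K_closed : closed K)
  (Kn_cantor : forall n, cantor_set (Kn n))
  (Kn_sub : forall n, Kn n `<=` K)
  (hulls_disjoint : trivIset [set: nat] (fun n => hull (Kn n)))
  (hulls_ordered : forall n x y, hull (Kn n) x -> hull (Kn n.+1) y -> x < y)
  (eps_gt0 : 0 < eps)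
  (Kn_thick : forall n, ((1 + eps)%:E < thickness (Kn n))%E)
  (a_gt0 : 0 < a) (a_lt_A : a < A)
  (hull_len : forall n, A <= len (hull (Kn n)) <= 2 * A)
  (hull_dist : forall n, set_dist (hull (Kn n)) (hull (Kn n.+1)) <= a) :
  let f := fun x : R => x ^+ 2 in
  let Kt := f @` K in
  exists E1 : R, `[E1, +oo[ `<=` set_sum Kt Kt.
Proof.
move=> f Kt.
have /choice[l /choice[r lrP]] n := cantor_hull (Kn_cantor n).
have Cl n : Kn n (l n) by case: (lrP n).
have Cr n : Kn n (r n) by case: (lrP n).
have lr n x : Kn n x -> l n <= x <= r n by case: (lrP n) => _ _ + _; apply.
have hE n : hull (Kn n) = `[l n, r n]%classic by case: (lrP n).
have hl n : hull (Kn n) (l n) by apply: sub_Rhull.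
have hr n : hull (Kn n) (r n) by apply: sub_Rhull.
have lenP n : A <= r n - l n <= 2 * A.
  have := hull_len n; rewrite hE /len sup_itvcc ?inf_itvcc //.
    by have /andP[] := lr _ _ (Cl n).
  by have /andP[] := lr _ _ (Cl n).
have ord n : r n < l n.+1 by apply: hulls_ordered (hr n) (hl n.+1).
have dist n : l n.+1 - r n <= a.
  apply: le_trans (hull_dist n); apply: lb_le_inf.
    by exists `|r n - l n.+1|, (r n) => //; exists (l n.+1).
  move=> _ [x hx [y hy <-]]; move: hx hy; rewrite !hE /= !in_itv /=.
  move=> /andP[_ x1] /andP[y1 _]; have := ord n => h.
  by rewrite ler0_norm; lra.
have lA n : l n + A <= l n.+1.
  by have /andP[? _] := lenP n; have := ord n; lra.
have lunb M : exists n, M <= l n.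
  have ln n : l 0%N + n%:R * A <= l n.
    elim: n => [|n IH]; first by rewrite mul0r addr0.
    by have := lA n; rewrite -natr1; lra.
  pose n := (Num.truncn ((M - l 0%N) / A)).+1; exists n.
  have : (M - l 0%N) / A < n%:R by apply: truncnS_gt.
  by rewrite ltr_pdivrMr; [have := ln n; lra|lra].
(* For hulls beyond [L], the first summand gives [r n <= (1 + eps) * l n], the second keeps the
   lengths of the squared hulls within a factor 3, and the third makes a squared hole no longer than
   the squared hull before it ([q3] below). *)
pose L := 2 * A / eps + 10 * A + (a ^+ 2 + 2 * A ^+ 2) / (2 * (A - a)).
have p1 : 0 <= 2 * A / eps by rewrite divr_ge0; lra.
have p2 : 0 <= (a ^+ 2 + 2 * A ^+ 2) / (2 * (A - a)).
  by rewrite divr_ge0; nra.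
have L1 : 2 * A <= eps * L.
  have : eps * (2 * A / eps) = 2 * A by rewrite mulrC divfK // gt_eqF.
  by rewrite /L; nra.
have L2 : 10 * A <= L by rewrite /L; lra.
have L3 : a ^+ 2 + 2 * A ^+ 2 <= 2 * (A - a) * L.
  have : 2 * (A - a) * ((a ^+ 2 + 2 * A ^+ 2) / (2 * (A - a))) =
         a ^+ 2 + 2 * A ^+ 2 by rewrite mulrC divfK // gt_eqF //; lra.
  by rewrite /L; nra.
have [k0 Lk0] := lunb L.
have lmono i j : (i <= j)%N -> l i <= l j.
  move=> ij; apply: (homo_leq (@lexx _ _) (@le_trans _ _)) ij => n.
  by have := lA n; lra.
exists (2 * l k0 ^+ 2) => E; rewrite /= in_itv /= andbT => E1.
have posl k : (k0 <= k)%N -> L <= l k by move=> /lmono; lra.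
have [k [k0k lo up]] : exists k,
    [/\ (k0 <= k)%N, 2 * l k ^+ 2 <= E & E < 2 * l k.+1 ^+ 2].
  have [||m []] := @exists_bracket R (fun i => 2 * l (k0 + i)%N ^+ 2) E.
  - by rewrite addn0.
  - have [n nE] := lunb (E + 1); exists n.
    have ln := lmono _ _ (leq_addl k0 n).
    have := posl (k0 + n)%N (leq_addr _ _); have := sqr_ge0 (l k0); nra.
  rewrite addnS => h1 h2; exists (k0 + m)%N; split=> //; exact: leq_addr.
have lk := posl _ k0k.
have /andP[h1 h2] := lenP k.+1; have /andP[h3 h4] := lenP k.
have h5 := ord k; have h6 := dist k; have h7 := lA k; have h8 := posl _ (leqW k0k).
have thick n := cantor_thick_gaps (Kn_cantor n) (Kn_thick n).
have [lo1 [hi1 [bl1 [br1 T1]]]] := thick k.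
have [lo2 [hi2 [bl2 [br2 T2]]]] := thick k.+1.
suff [x [y [Kx Ky <-]]] : exists x y, [/\ K x, K y & x ^+ 2 + y ^+ 2 = E].
  by exists (f x); [exists x|exists (f y); [exists y|]].
(* The pairs (K_k, K_k) and (K_k, K_(k+1)) suffice: the corresponding intervals
   of sums of squares of hull points cover [2 (l k)^2, 2 (l (k+1))^2]. *)
have [le|lt] := leP E (2 * r k ^+ 2).
  have ps : 0 < r k ^+ 2 - l k ^+ 2 by rewrite subr_gt0 ltr_pXn2r // ?nnegrE; lra.
  have [|||||||x [y [Kx Ky e]]] := sqr_sum_mem (E := E) T1 T1 (Cl k) (Cr k) (@lr k)
    (Cl k) (Cr k) (@lr k).
  - by lra.
  - by nra.
  - by lra.
  - by nra.
  - by lra.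
  - by lra.
  - by apply/andP; split; lra.
  by exists x, y; split=> //; apply: (Kn_sub k).
have [|||||||x [y [Kx Ky e]]] := sqr_sum_mem (E := E) T1 T2 (Cl k) (Cr k) (@lr k)
  (Cl k.+1) (Cr k.+1) (@lr k.+1).
- by lra.
- by nra.
- by lra.
- by nra.
- by nra.
- by nra.
(* By [q1] to [q3], [l k ^+ 2 + l k.+1 ^+ 2 <= 2 * r k ^+ 2], which is below [E]; by [q4] and [q5],
   [2 * l k.+1 ^+ 2], which is above [E], is at most [r k ^+ 2 + r k.+1 ^+ 2]. *)
- have q1 : (l k.+1 - r k) * (l k.+1 + r k) <= a * (2 * r k + a).
    by apply: ler_pM; lra.
  have q2 : A * (2 * r k - 2 * A) <= (r k - l k) * (r k + l k).
    by apply: ler_pM; lra.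
  have q3 : a * (2 * r k + a) <= A * (2 * r k - 2 * A) by nra.
  have q4 : (l k.+1 - r k) * (l k.+1 + r k) <= A * (2 * l k.+1).
    by apply: ler_pM; lra.
  have q5 : A * (2 * l k.+1) <= (r k.+1 - l k.+1) * (r k.+1 + l k.+1).
    by apply: ler_pM; lra.
  by apply/andP; split; lra.
by exists x, y; split=> //; [apply: (Kn_sub k)|apply: (Kn_sub k.+1)].
Qed.
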